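(* Let $G\neq K_4$ be a $4$-Ore graph with exactly four triangles. Let $x,y\in V(G)$ and $A,B\subseteq V(G)$ be such that: $A\cap B=\{x,y\}$, $A\cup B=V(G)$, no edge of $G$ joins $A\setminus\{x,y\}$ to $B\setminus\{x,y\}$; $x$ and $y$ are non-adjacent in $G$ and have no common neighbour in $B$; the graph $G'$ obtained from $G[A]$ by adding the edge $xy$ is $4$-Ore; and the graph $G''$ obtained from $G[B]$ by identifying $x$ and $y$ into a new vertex $x*y$ is $4$-Ore. Then both $G'$ and $G''$ are $4$-Ore graphs with exactly four triangles, $xy$ is a diamond edge of $G'$, and $G[B]$ has exactly two triangles. Furthermore, if $G''\neq K_4$, then $x*y$ belongs to exactly two triangles of $G''$.
   Context: An Ore-composition $O(G_1,G_2)$ of vertex-disjoint graphs: delete an edge $xy$ of $G_1$; split a vertex $z$ of $G_2$ into two new nonadjacent vertices $z_1,z_2$ of positive degree whose neighbourhoods partition that of $z$; identify $x$ with $z_1$ and $y$ with $z_2$. A graph is $4$-Ore if it is obtained from a set of copies of $K_4$ by a sequence of Ore-compositions. An edge is a diamond edge if it belongs to exactly two triangles. *)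

(* Defs.v *)
From mathcomp Require Import all_boot.

Set Implicit Arguments.
Unset Strict Implicit.
Unset Printing Implicit Defensive.

Record sgraph := SGraph {
  svertex :> finType;
  sedge : rel svertex;
  sedge_sym : symmetric sedge;
  sedge_irrefl : irreflexive sedge }.

Arguments sedge {s}.
Notation "u -- v" := (sedge u v) (at level 30, no associativity).

Definition neighbours (G : sgraph) (u : G) : {set G} := [set v | u -- v].

Definition isomorphic (G H : sgraph) : Prop :=
  exists f : G -> H, bijective f /\ forall u v, f u -- f v = u -- v.

Section Complete.
Variable n : nat.
Definition complete_edge : rel 'I_n := fun u v => u != v.
Lemma complete_sym : symmetric complete_edge.
Proof. by move=> u v; rewrite /complete_edge eq_sym. Qed.
Lemma complete_irrefl : irreflexive complete_edge.
Proof. by move=> u; rewrite /complete_edge eqxx. Qed.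
Definition complete : sgraph := SGraph complete_sym complete_irrefl.
End Complete.

Notation K4 := (complete 4).

Section Induced.
Variables (G : sgraph) (A : {set G}).
Definition induced_edge : rel {u : G | u \in A} := fun u v => val u -- val v.
Lemma induced_sym : symmetric induced_edge.
Proof. by move=> u v; rewrite /induced_edge sedge_sym. Qed.
Lemma induced_irrefl : irreflexive induced_edge.
Proof. by move=> u; rewrite /induced_edge sedge_irrefl. Qed.
Definition induced : sgraph := SGraph induced_sym induced_irrefl.
End Induced.

(* Graphs are loopless, so this is G itself when x = y. *)
Section AddEdge.
Variables (G : sgraph) (x y : G).
Definition add_edge_rel : rel G := fun u v =>
  u -- v || (x != y) && ((u == x) && (v == y) || (u == y) && (v == x)).
Lemma add_edge_sym : symmetric add_edge_rel.
Proof.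
move=> u v; rewrite /add_edge_rel sedge_sym; congr (_ || (_ && _)).
by rewrite orbC; congr orb; rewrite andbC.
Qed.
Lemma add_edge_irrefl : irreflexive add_edge_rel.
Proof.
move=> u; rewrite /add_edge_rel sedge_irrefl /=.
by rewrite [(u == y) && _]andbC orbb; case: (eqVneq u x) => [->|_]; rewrite ?andbF ?andNb.
Qed.
Definition add_edge : sgraph := SGraph add_edge_sym add_edge_irrefl.
End AddEdge.

(* None is the new vertex x*y. *)
Section Identify.
Variables (G : sgraph) (x y : G).
Definition identify_vertex : finType := option {u : G | u \notin [set x; y]}.
Definition identify_edge : rel identify_vertex := fun u v =>
  match u, v with
  | Some u, Some v => val u -- val v
  | None, Some w | Some w, None => x -- val w || y -- val w
  | None, None => false
  end.
Lemma identify_sym : symmetric identify_edge.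
Proof. by case=> [u|] [v|] //=; rewrite sedge_sym. Qed.
Lemma identify_irrefl : irreflexive identify_edge.
Proof. by case=> [u|] //=; rewrite sedge_irrefl. Qed.
Definition identify : sgraph := SGraph identify_sym identify_irrefl.
Definition identified : identify := None.
End Identify.

(* The vertex z of G2 is split into z1 and z2 with neighbourhoods N1 and N2.
   The vertices obtained by identifying x with z1 and y with z2 are inl x and
   inl y. *)
Section OreComposition.
Variables (G1 G2 : sgraph) (x y : G1) (z : G2) (N1 N2 : {set G2}).
Definition ore_vertex : finType := (G1 + {v : G2 | v != z})%type.
Definition ore_edge : rel ore_vertex := fun u v =>
  match u, v with
  | inl u, inl v => u -- v && ([set u; v] != [set x; y])
  | inr u, inr v => val u -- val v
  | inl u, inr w | inr w, inl u =>
      (u == x) && (val w \in N1) || (u == y) && (val w \in N2)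
  end.
Lemma ore_sym : symmetric ore_edge.
Proof. by case=> [u|u] [v|v] //=; rewrite sedge_sym // setUC. Qed.
Lemma ore_irrefl : irreflexive ore_edge.
Proof. by case=> u /=; rewrite sedge_irrefl. Qed.
Definition ore_graph : sgraph := SGraph ore_sym ore_irrefl.
End OreComposition.

Definition is_ore_composition (G G1 G2 : sgraph) : Prop :=
  exists (x y : G1) (z : G2) (N1 N2 : {set G2}),
    [/\ x -- y, N1 :|: N2 = neighbours z, [disjoint N1 & N2],
        (N1 != set0) && (N2 != set0)
      & isomorphic G (ore_graph x y z N1 N2)].

Inductive is_4Ore : sgraph -> Prop :=
| is_4Ore_K4 G : isomorphic G K4 -> is_4Ore G
| is_4Ore_comp G G1 G2 :
    is_4Ore G1 -> is_4Ore G2 -> is_ore_composition G G1 G2 -> is_4Ore G.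

Definition triangles (G : sgraph) : {set {set G}} :=
  [set T : {set G} | (#|T| == 3) &&
     [forall u in T, forall v in T, (u != v) ==> u -- v]].

Definition diamond_edge (G : sgraph) (u v : G) : Prop :=
  u -- v /\ #|[set T in triangles G | (u \in T) && (v \in T)]| = 2.

Section Separation.
Variables (G : sgraph) (x y : G) (A B : {set G}).
Lemma sepAx : A :&: B = [set x; y] -> x \in A.
Proof. by move=> AB; have := set21 x y; rewrite -AB => /setIP[]. Qed.
Lemma sepAy : A :&: B = [set x; y] -> y \in A.
Proof. by move=> AB; have := set22 x y; rewrite -AB => /setIP[]. Qed.
Lemma sepBx : A :&: B = [set x; y] -> x \in B.
Proof. by move=> AB; have := set21 x y; rewrite -AB => /setIP[]. Qed.
Lemma sepBy : A :&: B = [set x; y] -> y \in B.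
Proof. by move=> AB; have := set22 x y; rewrite -AB => /setIP[]. Qed.
End Separation.

(* Main.v *)
Require Import Defs.
From mathcomp Require Import all_boot.
From mathcomp Require Import zify.

(** Write t(G) for the number of triangles of G. For every 4-Ore graph, each
    edge e lies in at most two triangles, t(G) >= 4, t(G - e) >= 2 and
    t(G - v) >= 1; moreover t(G - v) >= 2 unless G = K4. All of this passes
    through an Ore-composition, because its triangles are those of G1 - xy
    together with those of the split of G2, and the latter contain the
    triangles of G2 - z and inject into those of G2. In the theorem, the four
    triangles of G are therefore divided as 2 + 2 between G' - xy and G[B],
    and all claims except the last one follow.

    The last claim is that t(G - v) = 2 bounds by 2 the number of triangles
    through v in a 4-Ore graph G other than K4. It is proved simultaneously
    with a companion: if v and w together meet all triangles of G, then each
    of them lies in at most two triangles. The companion serves when v is a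
    vertex of G2 - z, since z and v then meet all triangles of G2. *)

Set Implicit Arguments.
Unset Strict Implicit.
Unset Printing Implicit Defensive.

(** * Triangles and graph maps *)

Lemma trianglesP (G : sgraph) (T : {set G}) :
  reflect (#|T| = 3 /\ {in T &, forall u v, u != v -> u -- v})
          (T \in triangles G).
Proof.
rewrite inE; apply: (iffP andP) => [[/eqP cT /forall_inP eT]|[cT eT]].
  split=> // u v uT vT uv; have /forall_inP/(_ v vT) := eT u uT.
  by move/implyP; apply.
split; first by rewrite cT.
apply/forall_inP => u uT; apply/forall_inP => v vT; apply/implyP; exact: eT.
Qed.

Lemma sedge_neq (G : sgraph) (u v : G) : u -- v -> u != v.
Proof. by apply: contraTneq => ->; rewrite sedge_irrefl. Qed.

Lemma triangle_edge (G : sgraph) (T : {set G}) (g : G) : T \in triangles G -> g \in T ->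
  exists2 h, h \in T & g -- h.
Proof.
case/trianglesP=> cT eT gT.
have /card_gt0P[h] : 0 < #|T :\ g| by have := cardsD1 g T; rewrite gT cT; lia.
by rewrite !inE => /andP[hg hT]; exists h => //; apply: eT; rewrite // eq_sym.
Qed.

Lemma triangle3 (G : sgraph) (a b c : G) : a -- b -> a -- c -> b -- c ->
  [set a; b; c] \in triangles G.
Proof.
move=> ab ac bc; apply/trianglesP; split.
  rewrite setUC cardsU1 cards2 !inE negb_or.
  by rewrite ![c == _]eq_sym !sedge_neq.
have S (u v : G) : u -- v -> v -- u by rewrite sedge_sym.
move=> u v; rewrite !inE -!orbA.
by move=> /or3P[]/eqP-> /or3P[]/eqP->; rewrite ?eqxx // => _; auto.
Qed.

(** Used when the three neighbours of a vertex of K4 are shared out between the two halves of that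
    vertex. *)
Lemma pigeonhole3 (T : Type) (P Q : pred T) (a b c : T) :
  P a \/ Q a -> P b \/ Q b -> P c \/ Q c ->
  [\/ P a /\ P b \/ Q a /\ Q b, P a /\ P c \/ Q a /\ Q c
    | P b /\ P c \/ Q b /\ Q c].
Proof.
move=> [a1|a1] [b1|b1] [c1|c1];
  by [apply: Or31; tauto | apply: Or32; tauto | apply: Or33; tauto].
Qed.

(** Injectivity of [f] on [T] comes for free: distinct vertices of [T] are adjacent, so a common
    image would carry a loop. *)
Lemma imset_triangle (G H : sgraph) (f : G -> H) (T : {set G}) :
  T \in triangles G -> {in T &, forall u v, u -- v -> f u -- f v} ->
  f @: T \in triangles H.
Proof.
case/trianglesP=> cT eT fT; apply/trianglesP; split.
  rewrite card_in_imset // => u v uT vT fuv; apply/eqP/negPn/negP => uv.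
  by have := fT u v uT vT (eT u v uT vT uv); rewrite fuv sedge_irrefl.
move=> _ _ /imsetP[u uT ->] /imsetP[v vT ->] fuv.
by apply: fT => //; apply: eT => //; apply: contraNneq fuv => ->.
Qed.

(** * Counting triangles with a given property *)

Definition tcount (G : sgraph) (P : pred {set G}) : nat :=
  #|[set T in triangles G | P T]|.

Lemma in_tset (G : sgraph) (P : pred {set G}) (T : {set G}) :
  (T \in [set T in triangles G | P T]) = (T \in triangles G) && P T.
Proof. exact: in_set. Qed.

Lemma tcount_leq (G : sgraph) (P Q : pred {set G}) :
  (forall T, T \in triangles G -> P T -> Q T) -> tcount P <= tcount Q.
Proof.
move=> PQ; apply/subset_leq_card/subsetP => T.
by rewrite !in_tset => /andP[Tt /(PQ _ Tt) ->]; rewrite Tt.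
Qed.

Lemma eq_tcount (G : sgraph) (P Q : pred {set G}) :
  {in triangles G, P =1 Q} -> tcount P = tcount Q.
Proof.
by move=> PQ; apply/eqP; rewrite eqn_leq !tcount_leq // => T /PQ ->.
Qed.

Lemma tcount_eq0 (G : sgraph) (P : pred {set G}) :
  (forall T, T \in triangles G -> ~~ P T) -> tcount P = 0.
Proof.
move=> nP; apply/eqP; rewrite cards_eq0; apply/eqP/setP => T.
by rewrite in_tset in_set0; case: (boolP (T \in _)) => // /nP /negbTE.
Qed.

Lemma tcount_gt0 (G : sgraph) (P : pred {set G}) (T : {set G}) :
  T \in triangles G -> P T -> 0 < tcount P.
Proof. by move=> Tt PT; apply/card_gt0P; exists T; rewrite in_tset Tt. Qed.

Lemma tcount_split (G : sgraph) (Q P : pred {set G}) :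
  tcount P = tcount (fun T => P T && Q T) + tcount (fun T => P T && ~~ Q T).
Proof.
rewrite /tcount -(cardsID [set T | Q T]); congr (_ + _); apply: eq_card => T.
  by rewrite in_setI !in_tset in_set andbA.
by rewrite in_setD !in_tset in_set andbC -andbA.
Qed.

Lemma tcount_inj (G H : sgraph) (P : pred {set G}) (Q : pred {set H})
    (f : {set G} -> {set H}) :
  (forall T, T \in triangles G -> P T -> f T \in triangles H /\ Q (f T)) ->
  (forall S T, S \in triangles G -> P S -> T \in triangles G -> P T ->
     f S = f T -> S = T) ->
  tcount P <= tcount Q.
Proof.
move=> fP finj; rewrite /tcount -(card_in_imset (f := f)); last first.
  move=> S T; rewrite in_tset => /andP[St PS].
  by rewrite in_tset => /andP[Tt PT]; apply: finj.
apply/subset_leq_card/subsetP => _ /imsetP[T + ->]; rewrite in_tset.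
by case/andP=> Tt /(fP T Tt)[ft Qf]; rewrite in_tset ft.
Qed.

(** * The triangles of K4 *)

Definition kfour (G : sgraph) : bool :=
  (#|G| == 4) && [forall u : G, forall v : G, u -- v == (u != v)].

Lemma kfourP (G : sgraph) : reflect (isomorphic G K4) (kfour G).
Proof.
apply: (iffP andP) => [[/eqP c4 /forallP e]|[f [fbij fe]]].
  exists (fun u => cast_ord c4 (enum_rank u)); split.
    exists (fun k => enum_val (cast_ord (esym c4) k)) => u.
      by rewrite cast_ordK enum_rankK.
    by rewrite enum_valK cast_ordKV.
  move=> u v; have /forallP/(_ v)/eqP -> := e u.
  by rewrite /sedge /= /complete_edge (inj_eq (@cast_ord_inj _ _ _))
    (inj_eq enum_rank_inj).
split; first by rewrite (bij_eq_card fbij) card_ord.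
apply/forallP => u; apply/forallP => v; rewrite -fe /sedge /= /complete_edge.
by rewrite (inj_eq (bij_inj fbij)).
Qed.

Section KFour.
Variables (G : sgraph) (K : kfour G).

Lemma kfour_card : #|G| = 4. Proof. by case/andP: K => /eqP. Qed.

Lemma kfour_edge (u v : G) : u -- v = (u != v).
Proof. by case/andP: K => _ /forallP/(_ u)/forallP/(_ v)/eqP. Qed.

(** A triangle of K4 is determined by the vertex that it omits, so counting triangles becomes
    counting vertices. *)
Lemma kfour_tcount (P : pred {set G}) : tcount P = #|[set u | P (~: [set u])]|.
Proof.
have Cinj : injective (fun u : G => ~: [set u]).
  by move=> u v /setC_inj/set1_inj.
rewrite -(card_imset _ Cinj); apply: eq_card => T; rewrite in_tset.
apply/andP/imsetP => [[/trianglesP[cT _] PT]|[u + ->]].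
  have /eqP/cards1P[u Tu] : #|~: T| = 1 by have := cardsC T; rewrite kfour_card; lia.
  by exists u; rewrite ?inE -Tu setCK.
rewrite inE => Pu; split=> //; apply/trianglesP; split.
  by have := cardsC [set u]; rewrite kfour_card cards1; lia.
by move=> v w _ _; rewrite kfour_edge.
Qed.

Lemma kfour_tcount_all : tcount (fun _ : {set G} => true) = 4.
Proof. by rewrite kfour_tcount -kfour_card -cardsT; apply: eq_card => u; rewrite !inE. Qed.

Lemma kfour_tcount_avoid (z : G) : tcount (fun T => z \notin T) = 1.
Proof.
rewrite kfour_tcount -(cards1 z); apply: eq_card => u.
by rewrite !inE negbK eq_sym.
Qed.

Lemma kfour_tcount_edge (a b : G) : a -- b ->
  tcount (fun T : {set G} => ~~ ((a \in T) && (b \in T))) = 2.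
Proof.
move=> /sedge_neq ab; rewrite kfour_tcount.
rewrite (_ : [set _ | _] = [set a; b]) ?cards2 ?ab //.
by apply/setP => u; rewrite !inE negb_and !negbK ![u == _]eq_sym.
Qed.

End KFour.

(** * The invariants carried through Ore-compositions *)

Record strong_inv (G : sgraph) : Prop := StrongInv {
  avoid_ge2 : forall v : G, 2 <= tcount (fun T => v \notin T);
  through_le2 : forall v : G,
    tcount (fun T => v \notin T) <= 2 -> tcount (fun T => v \in T) <= 2;
  through_le2_pair : forall v w : G, v != w ->
    tcount (fun T => (v \notin T) && (w \notin T)) = 0 ->
    tcount (fun T => v \in T) <= 2 }.

(** No edge or vertex is actually deleted: the triangles of G - ab are those of G not containing
    both a and b, and those of G - v are those avoiding v. All three clauses of [strong_inv] fail
    for K4, where one triangle avoids a given vertex, three contain it, and any two vertices meet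
    all four; hence the alternative in [inv_strong]. *)
Record ore_inv (G : sgraph) : Prop := OreInv {
  inv_edge_avoid : forall a b : G, a -- b ->
    2 <= tcount (fun T : {set G} => ~~ ((a \in T) && (b \in T)));
  inv_all : 4 <= tcount (fun _ : {set G} => true);
  inv_edge_through : forall a b : G, a -- b ->
    tcount (fun T : {set G} => (a \in T) && (b \in T)) <= 2;
  inv_avoid : forall v : G, 1 <= tcount (fun T => v \notin T);
  inv_strong : kfour G \/ strong_inv G }.

Lemma kfour_inv (G : sgraph) : kfour G -> ore_inv G.
Proof.
move=> K; split; last by left.
- by move=> a b ab; rewrite kfour_tcount_edge.
- by rewrite kfour_tcount_all.
- move=> a b ab; have := kfour_tcount_all K.
  rewrite (tcount_split (fun T : {set G} => (a \in T) && (b \in T))) /=.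
  by rewrite (kfour_tcount_edge K ab); lia.
- by move=> v; rewrite kfour_tcount_avoid.
Qed.

(* G is an Ore-composition of G1 and G2 up to isomorphism, except that x = y
   and empty neighbourhoods are allowed: i embeds G1 minus the edge xy, and p,
   which is meaningful on B only, maps the split G2 onto G2 by merging i x and
   i y. *)
Record gluing (G G1 G2 : sgraph) (i : G1 -> G) (p : G -> G2) (B : {set G})
    (x y : G1) : Prop := Gluing {
  glue_inj : injective i;
  glue_AB : forall u, (i u \in B) = (u == x) || (u == y);
  glue_cover : forall g, g \notin B -> exists u, g = i u;
  glue_cross : forall u g,
    i u \notin B -> (forall v, g != i v) -> ~~ (i u -- g);
  glue_nonadj : ~~ (i x -- i y);
  glue_common : forall g, g \in B -> ~~ ((i x -- g) && (i y -- g));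
  glue_iE : forall u v, i u -- i v -> u -- v;
  glue_iedge : forall u v, u -- v ->
    i u -- i v \/ (u = x /\ v = y) \/ (u = y /\ v = x);
  glue_pxy : p (i x) = p (i y);
  glue_psurj : forall w, exists2 g, g \in B & p g = w;
  glue_pinj : forall g h, g \in B -> h \in B -> p g = p h ->
    g = h \/ (g = i x \/ g = i y) /\ (h = i x \/ h = i y);
  glue_pedge : forall g h, g \in B -> h \in B -> g -- h -> p g -- p h;
  glue_pE : forall g h, g \in B -> h \in B -> p g -- p h ->
    exists g' h', [/\ g' \in B, h' \in B, p g' = p g, p h' = p h & g' -- h'] }.

(** * Triangles of a gluing, side by side *)

Section Gluing.
Variables (G G1 G2 : sgraph) (i : G1 -> G) (p : G -> G2) (B : {set G}).
Variables (x y : G1) (gl : gluing i p B x y).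

Let A := [set i u | u in G1].
Let z := p (i x).

Let iinj := glue_inj gl.
Let inA u : i u \in A. Proof. exact: imset_f. Qed.
Let xB : i x \in B. Proof. by rewrite (glue_AB gl) eqxx. Qed.
Let yB : i y \in B. Proof. by rewrite (glue_AB gl) eqxx orbT. Qed.

Let AB g : g \in A -> g \in B -> g = i x \/ g = i y.
Proof.
by case/imsetP=> u _ ->; rewrite (glue_AB gl) => /orP[]/eqP->; [left|right].
Qed.

Let AUB g : g \notin B -> g \in A.
Proof. by case/(glue_cover gl) => u ->. Qed.

Let cross g h : g \notin B -> h \notin A -> ~~ (g -- h).
Proof.
move=> gB hA; case: (glue_cover gl gB) => u gu; move: gB; rewrite gu => uB.
apply: (glue_cross gl) => // v; apply: contraNneq hA => ->; exact: inA.
Qed.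

Lemma edge_sides g h :
  g -- h -> (g \in A) && (h \in A) \/ (g \in B) && (h \in B).
Proof.
move=> gh; case: (boolP (g \in A)) => gA; case: (boolP (h \in A)) => hA.
- by left.
- right; apply/andP; split; last by apply: contraNT hA => /AUB.
  by apply: contraTT gh => /cross; apply.
- right; apply/andP; split; first by apply: contraNT gA => /AUB.
  by apply: contraTT gh => /cross; rewrite sedge_sym; apply.
- by right; apply/andP; split; [apply: contraNT gA|apply: contraNT hA] => /AUB.
Qed.

Lemma edge_not_AB g h :
  g -- h -> g \in A -> h \in A -> ~~ ((g \in B) && (h \in B)).
Proof.
move=> gh gA hA; apply/negP => /andP[gB hB].
have := glue_nonadj gl; move: gh.
by case: (AB gA gB) => ->; case: (AB hA hB) => ->; rewrite ?sedge_irrefl //;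
  rewrite 1?sedge_sym => ->.
Qed.

(** The sides share only [i x] and [i y], too few for a triangle, and a triangle contained in
    neither side would have an edge across the separation. *)
Lemma triangle_sides (T : {set G}) :
  T \in triangles G -> (T \subset B) = ~~ (T \subset A).
Proof.
move=> Tt; have [cT eT] := trianglesP _ Tt.
case: (boolP (T \subset B)) => TB; case: (boolP (T \subset A)) => TA //=.
  have : T \subset [set i x; i y].
    apply/subsetP => g gT; rewrite !inE.
    by case: (AB (subsetP TA g gT) (subsetP TB g gT)) => ->; rewrite eqxx ?orbT.
  by move/subset_leq_card; rewrite cT cards2; case: (_ != _).
case/subsetPn: TB => g gT gB; case/subsetPn: TA => h hT hA.
have gh : g != h by apply: contraNneq hA => <-; apply: AUB.
by have := cross gB hA; rewrite eT.
Qed.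

Lemma tcount_sides (P : pred {set G}) :
  tcount P = tcount (fun T => (T \subset A) && P T)
             + tcount (fun T => (T \subset B) && P T).
Proof.
rewrite (tcount_split (fun T => T \subset A)); congr (_ + _);
  apply: eq_tcount => T Tt; first by rewrite andbC.
by rewrite (triangle_sides Tt) andbC.
Qed.

(** Triangles inside [A] pull back along [i]. If x and y differ, the pullback cannot contain both,
    because [i x] and [i y] are nonadjacent. The case [x == y] is kept since the separation of the
    theorem does not exclude it at the outset. *)
Lemma tcount_A_le (P : pred {set G}) (Q : pred {set G1}) :
  (forall T : {set G1}, ~~ ((x \in T) && (y \in T)) || (x == y) -> P (i @: T) -> Q T) ->
  tcount (fun T => (T \subset A) && P T) <= tcount Q.
Proof.
move=> PQ.
have iK (T : {set G}) : T \subset A -> i @: (i @^-1: T) = T.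
  move=> TA; apply/setP => g; apply/imsetP/idP => [[u + ->]|gT].
    by rewrite inE.
  by have /imsetP[u _ gu] := subsetP TA g gT; exists u; rewrite // inE -gu.
apply: (tcount_inj (f := fun T => i @^-1: T)).
  move=> T Tt /andP[TA PT]; have [cT eT] := trianglesP _ Tt.
  split.
    apply/trianglesP; split; first by rewrite -cT -[in RHS](iK T TA) card_imset.
    move=> u v; rewrite !inE => uT vT uv; apply: (glue_iE gl); apply: eT => //.
    by rewrite (inj_eq iinj).
  apply: PQ; last by rewrite iK.
  rewrite !inE; case: eqVneq => [|xy]; rewrite ?orbT // orbF.
  apply: contra (glue_nonadj gl) => /andP[xT yT]; apply: eT => //.
  by rewrite (inj_eq iinj).
by move=> S T _ /andP[SA _] _ /andP[TA _] ST; rewrite -(iK S SA) ST iK.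
Qed.

(** Only triangles through the edge xy can be lost under [i]; when x = y, looplessness means that
    none is lost. *)
Lemma tcount_A_ge (P : pred {set G}) (Q : pred {set G1}) :
  (forall T, Q T ->
     (~~ ((x \in T) && (y \in T)) || (x == y)) && P (i @: T)) ->
  tcount Q <= tcount (fun T => (T \subset A) && P T).
Proof.
move=> QP; apply: (tcount_inj (f := fun T : {set G1} => i @: T)); last first.
  by move=> S T _ _ _ _; apply: imset_inj.
move=> T Tt /QP/andP[xyT ->]; rewrite andbT; split; last first.
  by apply: imsetS; apply/subsetP.
apply: imset_triangle => // u v uT vT uv; case: (glue_iedge gl uv) => // uvxy.
case: eqVneq xyT => [xy _|_].
  by move: uv; case: uvxy => -[-> ->]; rewrite xy sedge_irrefl.
by rewrite orbF; case: uvxy => -[<- <-]; rewrite uT vT.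
Qed.

Lemma p_eq_z g : g \in B -> p g = z -> g = i x \/ g = i y.
Proof. by move=> gB /(glue_pinj gl gB xB) [->|[]//]; left. Qed.

Lemma p_injB g h : g \in B -> h \in B -> p g = p h -> p g != z -> g = h.
Proof.
move=> gB hB gh; case: (glue_pinj gl gB hB gh) => // -[gxy _] /eqP[].
by case: gxy => ->; rewrite -?(glue_pxy gl).
Qed.

Lemma p_edgeB g h : g \in B -> h \in B -> p g != z -> p h != z ->
  p g -- p h -> g -- h.
Proof.
move=> gB hB gz hz /(glue_pE gl gB hB)[g' [h' [g'B h'B gg hh]]].
by rewrite (p_injB g'B gB gg) ?gg // (p_injB h'B hB hh) ?hh.
Qed.

Lemma p_edge_z h : h \in B -> z -- p h -> i x -- h \/ i y -- h.
Proof.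
move=> hB zh; have hz : p h != z by rewrite eq_sym sedge_neq.
have [g' [h' [g'B h'B gg hh]]] := glue_pE gl xB hB zh.
rewrite (p_injB h'B hB hh) ?hh //.
by case: (p_eq_z g'B gg) => ->; [left|right].
Qed.

Lemma p_imset_in (T : {set G}) g : T \subset B -> g \in B -> p g != z ->
  (p g \in p @: T) = (g \in T).
Proof.
move=> TB gB gz; apply/imsetP/idP => [[h hT gh]|gT]; last by exists g.
by rewrite (p_injB gB (subsetP TB h hT) gh gz).
Qed.

Lemma p_triangle (T : {set G}) :
  T \in triangles G -> T \subset B -> p @: T \in triangles G2.
Proof.
move=> Tt TB; apply: imset_triangle => // g h gT hT.
by apply: (glue_pedge gl); apply: (subsetP TB).
Qed.

(* If the vertex over z were i x in S and i y in T, any other vertex of S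
   would be a common neighbour of i x and i y in B. *)
Lemma p_triangle_inj (S T : {set G}) :
  S \in triangles G -> S \subset B -> T \in triangles G -> T \subset B ->
  p @: S = p @: T -> S = T.
Proof.
have key (S' T' : {set G}) : S' \in triangles G -> S' \subset B ->
    T' \in triangles G -> T' \subset B -> p @: S' = p @: T' -> S' \subset T'.
  move=> St SB Tt TB ST; apply/subsetP => g gS.
  have gB := subsetP SB g gS.
  case: (eqVneq (p g) z) => [gz|gz]; last first.
    by rewrite -p_imset_in // -ST imset_f.
  have [h hS gh] := triangle_edge St gS.
  have hB := subsetP SB h hS.
  have hz : p h != z by rewrite -gz eq_sym sedge_neq // (glue_pedge gl).
  have hT : h \in T' by rewrite -p_imset_in // -ST imset_f.
  have : p g \in p @: T' by rewrite -ST imset_f.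
  case/imsetP => g' g'T gg'.
  have g'B := subsetP TB g' g'T.
  have [_ eT] := trianglesP _ Tt.
  have g'h : g' -- h.
    by apply: eT => //; apply: contraNneq hz => <-; rewrite -gg' gz.
  have := glue_common gl hB; rewrite negb_and.
  case: (p_eq_z gB gz) => e; case: (p_eq_z g'B (etrans (esym gg') gz)) => e';
    rewrite e ?e' in gh g'h g'T *; rewrite ?gh ?g'h //.
move=> St SB Tt TB ST; apply/eqP; rewrite eqEsubset.
by apply/andP; split; apply: key.
Qed.

Lemma tcount_B_le (P : pred {set G}) (Q : pred {set G2}) :
  (forall T, T \in triangles G -> T \subset B -> P T -> Q (p @: T)) ->
  tcount (fun T => (T \subset B) && P T) <= tcount Q.
Proof.
move=> PQ; apply: (tcount_inj (f := fun T : {set G} => p @: T)).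
  by move=> T Tt /andP[TB PT]; split; [apply: p_triangle | apply: PQ].
by move=> S T St /andP[SB _] Tt /andP[TB _]; apply: p_triangle_inj.
Qed.

(** Off z, the map [p] is bijective and reflects edges, so a triangle avoiding z lifts to its
    preimage in [B]. *)
Lemma tcount_B_ge (P : pred {set G}) (Q : pred {set G2}) :
  (forall T : {set G}, T \subset B -> i x \notin T -> i y \notin T -> Q (p @: T) -> P T) ->
  tcount (fun T => (z \notin T) && Q T)
    <= tcount (fun T => (T \subset B) && P T).
Proof.
move=> QP; pose f (T : {set G2}) := [set g in B | p g \in T].
have fK (T : {set G2}) : p @: f T = T.
  apply/setP => w; apply/imsetP/idP => [[g + ->]|wT].
    by rewrite inE => /andP[].
  by have [g gB gw] := glue_psurj gl w; exists g; rewrite // inE gB gw.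
apply: (tcount_inj (f := f)); last first.
  by move=> S T _ _ _ _ ST; rewrite -(fK S) ST fK.
move=> T Tt /andP[zT QT]; have [cT eT] := trianglesP _ Tt.
have nz g : g \in f T -> g \in B /\ p g != z.
  by rewrite inE => /andP[-> gT]; split=> //; apply: contraNneq zT => <-.
have fB : f T \subset B by apply/subsetP => g /nz[].
split; last first.
  rewrite fB QP ?fK // inE negb_and ?xB ?yB /= ?zT //.
  by rewrite -(glue_pxy gl).
apply/trianglesP; split.
  rewrite -cT -[in RHS](fK T) card_in_imset // => g h /nz[gB gz] /nz[hB _] gh.
  exact: p_injB gh gz.
move=> g h gf hf gh; have [gB gz] := nz g gf; have [hB hz] := nz h hf.
move: gf hf; rewrite !inE gB hB /= => gT hT.
apply: p_edgeB => //; apply: eT => //.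
by apply: contraNneq gh => pgh; rewrite (p_injB gB hB pgh gz).
Qed.

Section Counting.
Hypotheses (inv1 : ore_inv G1) (inv2 : ore_inv G2).

Lemma tcount_A_ge2 : x -- y -> 2 <= tcount (fun T : {set G} => T \subset A).
Proof.
move=> xy; apply: leq_trans (inv_edge_avoid inv1 xy) _.
rewrite (eq_tcount (Q := fun T => (T \subset A) && true)); last first.
  by move=> T _; rewrite andbT.
by apply: tcount_A_ge => T ->.
Qed.

Lemma tcount_B_avoid :
  tcount (fun T => z \notin T)
    <= tcount (fun T => [&& T \subset B, i x \notin T & i y \notin T]).
Proof.
rewrite (eq_tcount (Q := fun T => (z \notin T) && true)); last first.
  by move=> T _; rewrite andbT.
by apply: tcount_B_ge => T _ -> ->.
Qed.

(** If G2 is not K4, the triangles of G2 - z suffice. If it is K4, then G2 - z gives one triangle;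
    by the pigeonhole principle two of the three neighbours of z go to the same one of [i x] and
    [i y], and these three vertices form a second. *)
Lemma tcount_B_ge2 : 2 <= tcount (fun T : {set G} => T \subset B).
Proof.
case: (inv_strong inv2) => [K|S]; last first.
  apply: leq_trans (avoid_ge2 S z) _; apply: leq_trans tcount_B_avoid _.
  by apply: tcount_leq => T _ /andP[].
rewrite (tcount_split (fun T => (i x \notin T) && (i y \notin T))).
have := tcount_B_avoid; rewrite (kfour_tcount_avoid K) => le1.
rewrite -[2]/(1 + 1); apply: leq_add le1 _.
have cz : #|~: [set z]| = 3 by have := cardsC [set z]; rewrite (kfour_card K) cards1; lia.
have : 2 < #|~: [set z]| by rewrite cz.
case/card_gt2P=> a [b [c [[]]]]; rewrite !inE => az bz cz' [ab bc ca].
have [a' a'B pa] := glue_psurj gl a.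
have [b' b'B pb] := glue_psurj gl b.
have [c' c'B pc] := glue_psurj gl c.
have adj g : g \in B -> p g != z -> i x -- g \/ i y -- g.
  by move=> gB gz; apply: p_edge_z; rewrite // (kfour_edge K) eq_sym.
have tri u g h : u \in B -> (u == i x) || (u == i y) ->
    g \in B -> h \in B -> p g != z -> p h != z -> p g != p h ->
    u -- g -> u -- h ->
    0 < tcount (fun T => (T \subset B)
                   && ~~ ((i x \notin T) && (i y \notin T))).
  move=> uB uxy gB hB gz hz gh ug uh.
  apply: (tcount_gt0 (T := [set u; g; h])).
    by apply: triangle3 => //; apply: p_edgeB => //; rewrite (kfour_edge K).
  rewrite !subUset !sub1set uB gB hB /= negb_and !negbK !inE -!orbA.
  by case/orP: uxy => /eqP ->; rewrite eqxx ?orbT.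
subst a b c.
have xx : (i x == i x) || (i x == i y) by rewrite eqxx.
have yy : (i y == i x) || (i y == i y) by rewrite eqxx orbT.
have := pigeonhole3 (P := sedge (i x)) (Q := sedge (i y))
  (adj _ a'B az) (adj _ b'B bz) (adj _ c'B cz').
case=> -[[e f]|[e f]].
- exact: (tri (i x) a' b').
- exact: (tri (i y) a' b').
- by apply: (tri (i x) a' c') => //; rewrite eq_sym.
- by apply: (tri (i y) a' c') => //; rewrite eq_sym.
- exact: (tri (i x) b' c').
- exact: (tri (i y) b' c').
Qed.

Lemma tcount_A_le2_kfour : x -- y -> kfour G1 ->
  tcount (fun T : {set G} => T \subset A) <= 2.
Proof.
move=> xy K; rewrite -(kfour_tcount_edge K xy).
rewrite (eq_tcount (Q := fun T => (T \subset A) && true)); last first.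
  by move=> T _; rewrite andbT.
by apply: tcount_A_le => T; rewrite (negbTE (sedge_neq xy)) orbF.
Qed.

(** The vertex of [T] over z would be [i x] or [i y] and adjacent to both a and b, making b or a a
    common neighbour of [i x] and [i y] in [B]. *)
Lemma p_triangle_mixed (T : {set G}) a b : T \in triangles G -> T \subset B ->
  a \in B -> b \in B -> i x -- a -> i y -- b ->
  ~~ [&& z \in p @: T, p a \in p @: T & p b \in p @: T].
Proof.
move=> Tt TB aB bB xa yb; apply/and3P => -[zT aT bT].
have az : p a != z by rewrite eq_sym sedge_neq // (glue_pedge gl).
have bz : p b != z.
  by rewrite eq_sym /z (glue_pxy gl) sedge_neq // (glue_pedge gl).
rewrite !p_imset_in // in aT bT.
have [_ eT] := trianglesP _ Tt.
case/imsetP: zT => g gT /esym gz; have gB := subsetP TB g gT.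
have ga : g -- a by apply: eT => //; apply: contraNneq az => <-; apply/eqP.
have gb : g -- b by apply: eT => //; apply: contraNneq bz => <-; apply/eqP.
case: (p_eq_z gB gz) => e; rewrite e in ga gb.
  by have := glue_common gl bB; rewrite gb yb.
by have := glue_common gl aB; rewrite xa ga.
Qed.

(** The third neighbour c of z goes with a or with b. Splitting z destroys the two triangles that
    join z and the neighbour on the other side to each of the neighbours on c's side. *)
Lemma tcount_B_le2_kfour a b : kfour G2 ->
  a \in B -> b \in B -> i x -- a -> i y -- b ->
  tcount (fun T : {set G} => T \subset B) <= 2.
Proof.
move=> K aB bB xa yb.
have az : p a != z by rewrite eq_sym sedge_neq // (glue_pedge gl).
have bz : p b != z.
  by rewrite eq_sym /z (glue_pxy gl) sedge_neq // (glue_pedge gl).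
have : 0 < #|~: [set z; p a; p b]|.
  have := cardsC [set z; p a; p b]; rewrite (kfour_card K).
  have : #|[set z; p a; p b]| <= 3.
    rewrite setUC cardsU1 cards2; by case: (_ \notin _); case: (_ != _).
  lia.
case/card_gt0P=> c; rewrite !inE -!orbA => /norP[cz /norP[ca cb]].
have [c' c'B pc] := glue_psurj gl c; subst c.
have two (s t : G2) : #|[set s; t]| <= 2 by rewrite cards2; case: (_ != _).
(* The vertex omitted by an image triangle lies in {z, d, e} and in {z, f, e}, hence is z or e, as d
   and f differ. *)
have bound (d e f : G2) : d != f ->
    (forall T, T \in triangles G -> T \subset B ->
       ~~ [&& z \in p @: T, d \in p @: T & e \in p @: T] /\
       ~~ [&& z \in p @: T, f \in p @: T & e \in p @: T]) ->
    tcount (fun T : {set G} => T \subset B) <= 2.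
  move=> df H; apply: leq_trans (two z e).
  pose Q (S : {set G2}) := ~~ [&& z \in S, d \in S & e \in S] &&
                           ~~ [&& z \in S, f \in S & e \in S].
  rewrite (eq_tcount (Q := fun T => (T \subset B) && true)); last first.
    by move=> T _; rewrite andbT.
  apply: leq_trans (tcount_B_le (Q := Q) _) _.
    by move=> T Tt TB _; apply/andP; apply: H.
  rewrite (kfour_tcount K); apply/subset_leq_card/subsetP => u.
  rewrite !inE /Q !inE !negb_and !negbK ![_ == u]eq_sym.
  case: (u == z) => //=; case: (u == e); rewrite ?orbT // !orbF.
  by case/andP=> /eqP-> /eqP df'; rewrite df' eqxx in df.
have [xc|yc] : i x -- c' \/ i y -- c'.
  by apply: p_edge_z; rewrite // (kfour_edge K) eq_sym.
- apply: (bound (p a) (p b) (p c')); first by rewrite eq_sym.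
  by move=> T Tt TB; split; apply: p_triangle_mixed.
apply: (bound (p b) (p a) (p c')); first by rewrite eq_sym.
move=> T Tt TB; have := p_triangle_mixed Tt TB aB bB xa yb.
have := p_triangle_mixed Tt TB aB c'B xa yc.
by rewrite ![(p a \in _) && _]andbC.
Qed.

(** * Ore-compositions: xy is an edge and both halves of z have a neighbour *)

Section Composition.
Hypothesis xy : x -- y.
Variables (a0 b0 : G) (a0B : a0 \in B) (b0B : b0 \in B).
Hypotheses (xa0 : i x -- a0) (yb0 : i y -- b0).

Let tcount_A_notin g : g \notin A ->
  tcount (fun T : {set G} => T \subset A)
    <= tcount (fun T => (T \subset A) && (g \notin T)).
Proof.
move=> gA; apply: tcount_leq => T _ TA; rewrite TA.
by apply: contra gA; apply: (subsetP TA).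
Qed.

Let tcount_B_notin g : g \notin B ->
  tcount (fun T : {set G} => T \subset B)
    <= tcount (fun T => (T \subset B) && (g \notin T)).
Proof.
move=> gB; apply: tcount_leq => T _ TB; rewrite TB.
by apply: contra gB; apply: (subsetP TB).
Qed.

Let tcount_A_avoid u : (u == x) || (u == y) ->
  tcount (fun T => u \notin T)
    <= tcount (fun T => (T \subset A) && (i u \notin T)).
Proof.
move=> uxy; apply: tcount_A_ge => T uT; rewrite (mem_imset _ _ iinj) uT andbT.
by case/orP: uxy => /eqP <-; rewrite (negbTE uT) ?andbF.
Qed.

Let tcount_B_avoidA g : g \in A ->
  tcount (fun T => z \notin T)
    <= tcount (fun T => (T \subset B) && (g \notin T)).
Proof.
move=> gA; apply: leq_trans tcount_B_avoid _; apply: tcount_leq => T _.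
case/and3P=> TB xT yT; rewrite TB; apply/negP => gT.
by case: (AB gA (subsetP TB g gT)) => e; move: xT yT; rewrite -e gT.
Qed.

(** All triangles through g lie in [A], which has at most two if G1 is K4. Otherwise let u be the
    vertex of G1 over which g lies: a triangle of G1 avoiding u must use the edge xy, so there are
    at most two of these, and [through_le2] applies to u. *)
Lemma through_A_le2 g : g \notin B ->
  tcount (fun T => (T \subset A) && (g \notin T)) = 0 ->
  tcount (fun T => g \in T) <= 2.
Proof.
move=> gB tA0; rewrite tcount_sides.
rewrite [X in _ + X]tcount_eq0 ?addn0; last first.
  by move=> T _; apply: contra gB => /andP[/subsetP]; apply.
have [K|S] := inv_strong inv1.
  apply: leq_trans (tcount_A_le2_kfour xy K).
  by apply: tcount_leq => T _ /andP[].
case: (glue_cover gl gB) => u gu; subst g.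
apply: leq_trans (tcount_A_le (Q := fun T => u \in T) _) _.
  by move=> T _; rewrite mem_imset.
apply: (through_le2 S).
rewrite (tcount_split (fun T : {set G1} => (x \in T) && (y \in T))).
rewrite -[2]addn0; apply: leq_add.
  apply: leq_trans (inv_edge_through inv1 xy).
  by apply: tcount_leq => T _ /andP[].
rewrite -tA0; apply: tcount_A_ge => T /andP[uT ->].
by rewrite mem_imset.
Qed.

(** If G2 is not K4, a triangle of G2 avoiding z and [p g] would lift to one in [B] avoiding g. So z
    and [p g] meet all triangles of G2, and [through_le2_pair] applies. *)
Lemma through_B_le2 g : g \notin A ->
  tcount (fun T => (T \subset B) && (g \notin T)) = 0 ->
  tcount (fun T => g \in T) <= 2.
Proof.
move=> gA tB0; rewrite tcount_sides.
rewrite [X in X + _]tcount_eq0 ?add0n; last first.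
  by move=> T _; apply: contra gA => /andP[/subsetP]; apply.
have gB : g \in B by apply: contraNT gA; apply: AUB.
have gz : p g != z.
  by apply: contraNneq gA => /(p_eq_z gB)[] ->; apply: inA.
have [K|S] := inv_strong inv2.
  apply: leq_trans (tcount_B_le2_kfour K a0B b0B xa0 yb0).
  by apply: tcount_leq => T _ /andP[].
apply: leq_trans (tcount_B_le (Q := fun T => p g \in T) _) _.
  by move=> T _ TB; rewrite p_imset_in.
apply: (through_le2_pair S) gz _; apply/eqP; rewrite -leqn0 -tB0.
rewrite (eq_tcount (Q := fun T => (z \notin T) && (p g \notin T))); last first.
  by move=> T _; rewrite andbC.
by apply: tcount_B_ge => T TB _ _; apply: contra; apply: imset_f.
Qed.

(** If g misses a side, the two triangles of that side avoid it. Otherwise g is [i x] or [i y], and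
    each side contributes one triangle, from G1 - x or G1 - y and from G2 - z. *)
Lemma gluing_avoid_ge2 (g : G) : 2 <= tcount (fun T => g \notin T).
Proof.
rewrite tcount_sides; have A2 := tcount_A_ge2 xy; have B2 := tcount_B_ge2.
case: (boolP (g \in A)) => gA; last by have := tcount_A_notin gA; lia.
case: (boolP (g \in B)) => gB; last by have := tcount_B_notin gB; lia.
have leB := leq_trans (inv_avoid inv2 z) (tcount_B_avoidA gA).
rewrite -[2]/(1 + 1); apply: leq_add leB.
case/imsetP: gA gB => u _ ->; rewrite (glue_AB gl) => /tcount_A_avoid.
exact: leq_trans (inv_avoid inv1 u).
Qed.

Lemma gluing_strong : strong_inv G.
Proof.
have A2 := tcount_A_ge2 xy; have B2 := tcount_B_ge2.
split; first exact: gluing_avoid_ge2.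
(* If g misses one side, the two triangles there already exhaust the bound, so every triangle on the
   other side contains g. *)
- move=> g; case: (boolP (g \in A)) => gA; last first.
    rewrite tcount_sides => le2; apply: through_B_le2 => //.
    by have := tcount_A_notin gA; lia.
  case: (boolP (g \in B)) => gB; last first.
    rewrite tcount_sides => le2; apply: through_A_le2 => //.
    by have := tcount_B_notin gB; lia.
  (* Now g is [i x] or [i y], and each side has exactly one triangle avoiding it. By [avoid_ge2]
     this forces G1 and G2 to be K4, so G has at most four triangles, two of which avoid g. *)
  move=> le2; have ge2 := gluing_avoid_ge2 g.
  have := tcount_split (fun T => g \in T) (fun _ : {set G} => true).
  rewrite /= => tot.
  suff : tcount (fun _ : {set G} => true) <= 4 by rewrite tot; lia.
  rewrite tcount_sides.
  rewrite (eq_tcount (Q := fun T => T \subset A)); last first.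
    by move=> T _; rewrite andbT.
  rewrite [X in _ + X](eq_tcount (Q := fun T => T \subset B)); last first.
    by move=> T _; rewrite andbT.
  move: le2; rewrite tcount_sides => le2; have leB := tcount_B_avoidA gA.
  have {gA gB} [u leA] : exists u : G1, tcount (fun T => u \notin T)
      <= tcount (fun T => (T \subset A) && (g \notin T)).
    case/imsetP: gA gB => u _ ->; rewrite (glue_AB gl) => /tcount_A_avoid.
    by exists u.
  have ge1A := leq_trans (inv_avoid inv1 u) leA.
  have ge1B := leq_trans (inv_avoid inv2 z) leB.
  have K1 : kfour G1.
    case: (inv_strong inv1) => // S.
    by have := leq_trans (avoid_ge2 S u) leA; lia.
  have K2 : kfour G2.
    case: (inv_strong inv2) => // S.
    by have := leq_trans (avoid_ge2 S z) leB; lia.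
  have := tcount_A_le2_kfour xy K1.
  by have := tcount_B_le2_kfour K2 a0B b0B xa0 yb0; lia.
move=> g h gh t0; have := t0; rewrite tcount_sides => /eqP.
rewrite addn_eq0 => /andP[/eqP tA0 /eqP tB0].
have inAB k : k \in A -> k \in B ->
    1 <= tcount (fun T => (T \subset A) && (k \notin T)).
  case/imsetP=> u _ ->; rewrite (glue_AB gl) => /tcount_A_avoid.
  exact: leq_trans (inv_avoid inv1 u).
have outA k (T : {set G}) : k \notin A -> T \subset A -> k \notin T.
  by move=> kA TA; apply: contra kA; apply: (subsetP TA).
have outB k (T : {set G}) : k \notin B -> T \subset B -> k \notin T.
  by move=> kB TB; apply: contra kB; apply: (subsetP TB).
case: (boolP (g \in A)) => gA; case: (boolP (h \in A)) => hA.
(* Both in [A] is impossible: a triangle of G2 - z lifts to one in [B] that avoids [i x] and [i y],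
   hence g and h. *)
- suff : 1 <= tcount (fun T => (T \subset B) && ((g \notin T) && (h \notin T))).
    by rewrite tB0.
  apply: leq_trans (inv_avoid inv2 z) _; apply: leq_trans tcount_B_avoid _.
  apply: tcount_leq => T _ /and3P[TB xT yT]; rewrite TB /=.
  apply/andP; split; apply/negP => kT.
    by case: (AB gA (subsetP TB g kT)) => e; move: xT yT; rewrite -e kT.
  by case: (AB hA (subsetP TB h kT)) => e; move: xT yT; rewrite -e kT.
(* Every triangle in [A] contains g, as h is outside [A]; by [inAB], g is then not in [B]. *)
- have tA : tcount (fun T => (T \subset A) && (g \notin T)) = 0.
    apply/eqP; rewrite -leqn0 -tA0; apply: tcount_leq => T _ /andP[TA ->].
    by rewrite TA outA.
  apply: through_A_le2 => //; apply/negP => gB.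
  by have := inAB g gA gB; rewrite tA.
(* By the same argument h is not in [B], so every triangle in [B] must contain g. *)
- have tA : tcount (fun T => (T \subset A) && (h \notin T)) = 0.
    apply/eqP; rewrite -leqn0 -tA0; apply: tcount_leq => T _ /andP[TA ->].
    by rewrite TA outA.
  apply: through_B_le2 => //.
  have hB : h \notin B by apply/negP => hB; have := inAB h hA hB; rewrite tA.
  apply/eqP; rewrite -leqn0 -tB0; apply: tcount_leq => T _ /andP[TB ->].
  by rewrite TB outB.
- suff : tcount (fun T : {set G} => T \subset A) <= 0 by move/(leq_trans A2).
  rewrite -tA0; apply: tcount_leq => T _ TA.
  by rewrite TA (outA _ _ gA TA) (outA _ _ hA TA).
Qed.

(** An edge of G lies on exactly one side, since [i x] and [i y] are nonadjacent. The two triangles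
    of the other side do not contain it, and the triangles that do are counted in G1 or in G2
    alone. *)
Lemma gluing_inv : ore_inv G.
Proof.
have A2 := tcount_A_ge2 xy; have B2 := tcount_B_ge2.
have noB g h : g -- h -> g \in A -> h \in A -> forall T : {set G},
    T \subset B -> ~~ ((g \in T) && (h \in T)).
  move=> gh gA hA T TB; apply: contra (edge_not_AB gh gA hA) => /andP[gT hT].
  by rewrite !(subsetP TB).
have noA g h : g -- h -> g \in B -> h \in B -> forall T : {set G},
    T \subset A -> ~~ ((g \in T) && (h \in T)).
  move=> gh gB hB T TA; apply/negP => /andP[gT hT].
  by have := edge_not_AB gh (subsetP TA g gT) (subsetP TA h hT); rewrite gB hB.
split.
- move=> g h gh; case: (edge_sides gh) => /andP[gS hS].
    by apply: leq_trans B2 _; apply: tcount_leq => T _; apply: noB.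
  by apply: leq_trans A2 _; apply: tcount_leq => T _; apply: noA.
- rewrite tcount_sides -[4]/(2 + 2); apply: leq_add.
    by apply: leq_trans A2 _; apply: tcount_leq => T _ ->.
  by apply: leq_trans B2 _; apply: tcount_leq => T _ ->.
- move=> g h gh; rewrite tcount_sides; case: (edge_sides gh) => /andP[gS hS].
    rewrite [X in _ + X]tcount_eq0 ?addn0; last first.
      by move=> T _; apply/andP => -[/(noB _ _ gh gS hS) /negP].
    case/imsetP: gS gh => u _ ->; case/imsetP: hS => v _ -> /(glue_iE gl) uv.
    apply: leq_trans (inv_edge_through inv1 uv).
    by apply: tcount_A_le => T _; rewrite !mem_imset.
  rewrite [X in X + _]tcount_eq0 ?add0n; last first.
    by move=> T _; apply/andP => -[/(noA _ _ gh gS hS) /negP].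
  apply: leq_trans (inv_edge_through inv2 (glue_pedge gl gS hS gh)).
  by apply: tcount_B_le => T _ _ /andP[gT hT]; rewrite !imset_f.
- by move=> g; have := gluing_avoid_ge2 g; lia.
- by right; apply: gluing_strong.
Qed.

End Composition.
End Counting.
End Gluing.

(** * From Ore-compositions to gluings, and the invariants of 4-Ore graphs *)

Lemma ore_composition_gluing (G G1 G2 : sgraph) :
  is_ore_composition G G1 G2 ->
  exists (i : G1 -> G) (p : G -> G2) (B : {set G}) (x y : G1) (a b : G),
    [/\ gluing i p B x y, x -- y, a \in B, b \in B & i x -- a /\ i y -- b].
Proof.
case=> x [y [z [N1 [N2 [xy N12 dN /andP[N1n N2n] [h [[k hK kK] hE]]]]]]].
(* [B] carries the split G2, whose halves of z are the vertices [inl x] and [inl y]. The value z of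
   [p] at the other vertices of G1 is a default. *)
pose B := [set g | if h g is inl u then (u == x) || (u == y) else true].
pose p g := if h g is inr w then val w else z.
have kE u v : k u -- k v = @ore_edge G1 G2 x y z N1 N2 u v by rewrite -hE !kK.
have Nz w : (w \in N1) || (w \in N2) = z -- w.
  by have := in_set (sedge z) w; rewrite -/(neighbours z) -N12 inE.
have nz w : (w \in N1) || (w \in N2) -> w != z.
  by rewrite Nz eq_sym; apply: sedge_neq.
have N12F w : w \in N1 -> w \in N2 -> False.
  by move=> w1 w2; move/pred0P/(_ w): dN; rewrite /= w1 w2.
have kP g : exists u, g = k u by exists (h g); rewrite hK.
have inB u : (k u \in B) = if u is inl u then (u == x) || (u == y) else true.
  by rewrite inE kK.
have pk u : p (k u) = if u is inr w then val w else z by rewrite /p kK.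
have yx : y != x by rewrite eq_sym sedge_neq.
have [a aN] := set0Pn _ N1n; have [b bN] := set0Pn _ N2n.
have az : a != z by rewrite nz ?aN.
have bz : b != z by rewrite nz ?bN ?orbT.
exists (fun u => k (inl u)), p, B, x, y.
exists (k (inr (exist _ a az))), (k (inr (exist _ b bz))).
split; rewrite ?inB //; last first.
  by rewrite !kE /= !eqxx aN bN orbT.
split.
- by move=> u v /(can_inj kK)[].
- by move=> u; rewrite inB.
- move=> g; have [[u|w] ->] := kP g; first by exists u.
  by rewrite inB.
- move=> u g; have [[v|w] ->] := kP g; first by move=> _ /(_ v); rewrite eqxx.
  rewrite inB => /norP[ux uy] _.
  by rewrite kE /= (negbTE ux) (negbTE uy).
- by rewrite kE /= eqxx andbF.
- move=> g; have [[v|w] ->] := kP g; rewrite inB !kE /=.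
    by case/orP=> /eqP ->; rewrite ?sedge_irrefl ?andbF.
  rewrite !eqxx (negbTE yx) eq_sym (negbTE yx) orbF /= => _.
  by apply/andP => -[/N12F].
- by move=> u v; rewrite kE /= => /andP[].
- move=> u v uv; rewrite kE /= uv /=.
  case: eqVneq => [/setP e|]; [right|by left].
  have := e u; have := e v; rewrite !inE !eqxx ?orbT /=.
  move=> /esym/orP[]/eqP ev /esym/orP[]/eqP eu; subst u v;
    rewrite ?sedge_irrefl // in uv *; by [left | right].
- by rewrite !pk.
- move=> w; case: (eqVneq w z) => [->|wz].
    by exists (k (inl x)); rewrite ?inB ?eqxx ?pk.
  by exists (k (inr (exist _ w wz))); rewrite ?inB ?pk.
- move=> g g'; have [[u|w] ->] := kP g; have [[u'|w'] ->] := kP g';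
    rewrite !inB !pk /=.
  + move=> /orP[]/eqP-> /orP[]/eqP-> _; right; split; by [left|right].
  + by move=> _ _ zw; have := valP w'; rewrite /= -zw eqxx.
  + by move=> _ _ zw; have := valP w; rewrite /= zw eqxx.
  + by move=> _ _ /val_inj->; left.
- move=> g g'; have [[u|w] ->] := kP g; have [[u'|w'] ->] := kP g';
    rewrite !inB !pk !kE /=.
  + by move=> /orP[]/eqP-> /orP[]/eqP->; rewrite ?sedge_irrefl ?eqxx ?andbF //
      [[set y; x]]setUC eqxx andbF.
  + by move=> _ _ /orP[]/andP[_ w1]; rewrite -Nz w1 ?orbT.
  + by move=> _ _ /orP[]/andP[_ w1]; rewrite sedge_sym -Nz w1 ?orbT.
  + by [].
- have zcase (w : {v : G2 | v != z}) : z -- val w ->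
      exists u, k (inl u) \in B /\ k (inl u) -- k (inr w).
    rewrite -Nz => /orP[wN|wN]; [exists x|exists y];
      by rewrite inB kE /= eqxx wN ?orbT.
  move=> g g' gB g'B.
  have [[u|w] gE] := kP g; have [[u'|w'] g'E] := kP g'; subst g g'; rewrite !pk /=.
  + by rewrite sedge_irrefl.
  + case/zcase=> v [vB vw]; exists (k (inl v)), (k (inr w')).
    by rewrite !pk.
  + rewrite sedge_sym => /zcase[v [vB vw]].
    exists (k (inr w)), (k (inl v)).
    by rewrite !pk sedge_sym.
  + move=> ww'; exists (k (inr w)), (k (inr w')).
    by rewrite !pk kE.
Qed.

Lemma is_4Ore_inv (G : sgraph) : is_4Ore G -> ore_inv G.
Proof.
elim=> {G} [G /kfourP|G G1 G2 _ inv1 _ inv2]; first exact: kfour_inv.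
case/ore_composition_gluing=> i [p [B [x [y [a [b [gl xy aB bB [xa yb]]]]]]]].
exact: (gluing_inv gl inv1 inv2 xy aB bB).
Qed.

(** * The separation of the theorem as a gluing *)

Section SeparationGluing.
Variables (G : sgraph) (x y : G) (A B : {set G}).
Hypotheses (AB : A :&: B = [set x; y]) (AUB : A :|: B = [set: G]).
Hypothesis no_cross : forall u v : G,
  u \in A :\: [set x; y] -> v \in B :\: [set x; y] -> ~~ (u -- v).
Hypothesis xy_nonadj : ~~ (x -- y).
Hypothesis no_common : forall v : G, v \in B -> ~~ ((x -- v) && (y -- v)).

Let xA : induced A := exist _ x (sepAx AB).
Let yA : induced A := exist _ y (sepAy AB).
Let xB : induced B := exist _ x (sepBx AB).
Let yB : induced B := exist _ y (sepBy AB).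

(** The outer [insub] tests membership in [B], the inner one being neither x nor y. Thus [None] is
    the image of x and y, and also the default outside [B]. *)
Definition separation_quotient (g : G) : identify xB yB :=
  if insub g : option (induced B) is Some u then insub u else None.

Lemma separation_quotientK (w : {u : induced B | u \notin [set xB; yB]}) :
  separation_quotient (val (val w)) = Some w.
Proof. by rewrite /separation_quotient !valK. Qed.

Variant separation_quotient_spec (g : G) : identify xB yB -> Type :=
  | QuotientIdentified of (g == x) || (g == y) :
      separation_quotient_spec g None
  | QuotientOther w of val (val w) = g & g != x & g != y :
      separation_quotient_spec g (Some w).

Lemma separation_quotientP (g : G) :
  g \in B -> separation_quotient_spec g (separation_quotient g).
Proof.
move=> gB; rewrite /separation_quotient insubT /=.
case: insubP => [w wxy wg|].
  have vw : val (val w) = g by rewrite wg.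
  move: wxy; rewrite !inE -!(inj_eq val_inj) /= => /norP[gx gy].
  exact: QuotientOther.
by rewrite negbK !inE -!(inj_eq val_inj) => gxy; apply: QuotientIdentified.
Qed.

Lemma separation_gluing :
  @gluing G (add_edge xA yA) (identify xB yB) val separation_quotient B xA yA.
Proof.
have inAB g : (g \in A) && (g \in B) = (g == x) || (g == y).
  by rewrite -in_setI AB !inE.
have inAUB g : (g \in A) || (g \in B) by rewrite -in_setU AUB inE.
have qx : separation_quotient x = None.
  by case: (separation_quotientP (sepBx AB)) => // w _; rewrite eqxx.
have qy : separation_quotient y = None.
  by case: (separation_quotientP (sepBy AB)) => // w _ _; rewrite eqxx.
have eNS (w : {u : induced B | u \notin [set xB; yB]}) :
  @sedge (identify xB yB) None (Some w) = x -- val (val w) || y -- val (val w) by [].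
have eSN (w : {u : induced B | u \notin [set xB; yB]}) :
  @sedge (identify xB yB) (Some w) None = x -- val (val w) || y -- val (val w) by [].
have eSS (w w' : {u : induced B | u \notin [set xB; yB]}) :
  @sedge (identify xB yB) (Some w) (Some w') = val (val w) -- val (val w') by [].
split.
- exact: val_inj.
- by case=> u uA; rewrite -!(inj_eq val_inj) /= -inAB uA.
- move=> g gB; have := inAUB g; rewrite (negbTE gB) orbF => gA.
  by exists (exist _ g gA).
- case=> u uA g /= uB gA.
  have gNA : g \notin A.
    by apply/negP => gA'; have /eqP[] := gA (exist _ g gA').
  have := inAUB g; rewrite (negbTE gNA) /= => gB.
  apply: no_cross; rewrite !inE -inAB ?(negbTE uB) ?(negbTE gNA) ?andbF //.
- exact: xy_nonadj.
- exact: no_common.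
- by move=> u v uv; apply/orP; left.
- move=> u v /orP[uv|/andP[_ /orP[]/andP[/eqP-> /eqP->]]]; first by left.
    by right; left.
  by right; right.
- by rewrite /= qx qy.
- case=> [w|]; last by exists x; rewrite ?qx ?(sepBx AB).
  by exists (val (val w)); [apply: valP | apply: separation_quotientK].
- move=> g h gB hB.
  case: (separation_quotientP gB) => [/orP gxy|w wg _ _];
    case: (separation_quotientP hB) => [/orP hxy|w' wh _ _] //.
    by move=> _; right; split; [case: gxy|case: hxy] => /eqP->; by [left|right].
  by case=> e; left; rewrite -wg -wh e.
- move=> g h gB hB gh.
  case: (separation_quotientP gB) => [gxy|w wg _ _];
    case: (separation_quotientP hB) => [hxy|w' wh _ _].
  + move: gh xy_nonadj; case/orP: gxy => /eqP->; case/orP: hxy => /eqP->;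
      by rewrite ?sedge_irrefl // 1?sedge_sym => ->.
  + rewrite eNS wh.
    by case/orP: gxy gh => /eqP-> ->; rewrite ?orbT.
  + rewrite eSN wg.
    by rewrite sedge_sym in gh; case/orP: hxy gh => /eqP-> ->; rewrite ?orbT.
  + by rewrite eSS wg wh.
- move=> g h gB hB.
  case: (separation_quotientP gB) => [gxy|w wg _ _];
    case: (separation_quotientP hB) => [hxy|w' wh _ _].
  + by rewrite sedge_irrefl.
  + rewrite eNS wh => /orP[] e.
      by exists x, h; rewrite (sepBx AB) qx -{2}wh separation_quotientK.
    by exists y, h; rewrite (sepBy AB) qy -{2}wh separation_quotientK.
  + rewrite eSN wg => /orP[] e.
      by exists g, x; rewrite (sepBx AB) qx -{2}wg separation_quotientK sedge_sym.
    by exists g, y; rewrite (sepBy AB) qy -{2}wg separation_quotientK sedge_sym.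
  + rewrite eSS wg wh => e.
    by exists g, h; rewrite -{2}wg -{2}wh !separation_quotientK.
Qed.

End SeparationGluing.

(** * Deriving the theorem from the counts on the two sides *)

Lemma card_triangles (G : sgraph) :
  #|triangles G| = tcount (fun _ : {set G} => true).
Proof. by apply: eq_card => T; rewrite in_tset andbT. Qed.

Lemma four_triangles (G : sgraph) (P : pred {set G}) :
  ore_inv G -> tcount P <= 2 -> tcount (fun T => ~~ P T) <= 2 ->
  #|triangles G| = 4 /\ tcount P = 2.
Proof.
move=> inv le1 le2; have ge4 := inv_all inv; rewrite card_triangles.
have E : tcount (fun _ : {set G} => true) = tcount P + tcount (fun T => ~~ P T).
  by rewrite (tcount_split P); congr (_ + _); apply: eq_tcount.
by split; lia.
Qed.

Lemma card_triangles_induced (G : sgraph) (B : {set G}) :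
  #|triangles (induced B)| = tcount (fun T : {set G} => T \subset B).
Proof.
rewrite -(card_imset _ (imset_inj (val_inj : injective (val : induced B -> G)))).
apply: eq_card => T; rewrite in_tset; apply/imsetP/andP.
  case=> S St ->; split; first exact: imset_triangle.
  by apply/subsetP => _ /imsetP[u _ ->]; apply: valP.
case=> Tt TB; exists (val @^-1: T).
  have [cT eT] := trianglesP _ Tt; apply/trianglesP; split.
    rewrite -cT -(card_imset _ (val_inj : injective (val : induced B -> G))).
    apply: eq_card => g; apply/imsetP/idP => [[u + ->]|gT]; first by rewrite inE.
    by exists (exist _ g (subsetP TB g gT)); rewrite ?inE.
  move=> u v; rewrite !inE => uT vT uv; exact: eT.
apply/setP => g; apply/idP/imsetP => [gT|[u + ->]]; last by rewrite inE.
by exists (exist _ g (subsetP TB g gT)); rewrite ?inE.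
Qed.

Theorem theorem11 (G : sgraph) (x y : G) (A B : {set G})
  (G_4Ore : is_4Ore G)
  (G_neq_K4 : ~ isomorphic G K4)
  (G_triangles : #|triangles G| = 4)
  (AB : A :&: B = [set x; y])
  (AUB : A :|: B = [set: G])
  (no_cross : forall u v : G,
     u \in A :\: [set x; y] -> v \in B :\: [set x; y] -> ~~ (u -- v))
  (xy_nonadj : ~~ (x -- y))
  (no_common : forall v : G, v \in B -> ~~ ((x -- v) && (y -- v))) :
  let xA : induced A := exist _ x (sepAx AB) in
  let yA : induced A := exist _ y (sepAy AB) in
  let xB : induced B := exist _ x (sepBx AB) in
  let yB : induced B := exist _ y (sepBy AB) in
  let G' := add_edge xA yA in
  let G'' := identify xB yB in
  is_4Ore G' ->
  is_4Ore G'' ->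
  [/\ is_4Ore G' /\ #|triangles G'| = 4,
      is_4Ore G'' /\ #|triangles G''| = 4,
      @diamond_edge G' xA yA,
      #|triangles (induced B)| = 2
    & ~ isomorphic G'' K4 ->
        #|[set T in triangles G'' | identified xB yB \in T]| = 2].

Proof.
move=> xA yA xB yB G' G'' G'_4Ore G''_4Ore.
have inv1 := is_4Ore_inv G'_4Ore; have inv2 := is_4Ore_inv G''_4Ore.
have gl := separation_gluing AB AUB no_cross xy_nonadj no_common.
have B2 := tcount_B_ge2 gl inv2.
set p := @separation_quotient G x y A B AB in gl.
set tA := tcount (fun T : {set G} => T \subset [set val u | u in G']).
set tB := tcount (fun T : {set G} => T \subset B) in B2 *.
have tot : tA + tB = 4.
  rewrite -G_triangles card_triangles (tcount_sides gl).
  by congr (_ + _); apply: eq_tcount => T _; rewrite andbT.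
have geA (Q : pred {set G'}) : (forall T, Q T ->
    ~~ ((xA \in T) && (yA \in T)) || (xA == yA)) -> tcount Q <= tA.
  move=> QP; apply: leq_trans (tcount_A_ge (P := fun _ => true) gl (Q := Q) _) _.
    by move=> T /QP ->.
  by apply: tcount_leq => T _ /andP[].
(* If x = y, no edge is added, so all triangles of G', at least four, lie in [A]; with the two in
   [B] this exceeds four. *)
have xy : xA != yA.
  apply/negP => /eqP xy; have := geA (fun _ => true).
  rewrite xy eqxx => /(_ (fun _ _ => orbT _))/(leq_trans (inv_all inv1)).
  lia.
have exy : @sedge G' xA yA by apply/orP; right; rewrite xy !eqxx.
have A2 : 2 <= tA := tcount_A_ge2 gl inv1 exy.
have tB2 : tB = 2 by lia.
have tA2 : tA = 2 by lia.
have avoid1 : tcount (fun T : {set G'} => ~~ ((xA \in T) && (yA \in T))) <= 2.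
  by rewrite -tA2; apply: geA => T ->.
have [tri1 through1] := @four_triangles G' _ inv1 (inv_edge_through inv1 exy) avoid1.
(* Triangles of G'' avoiding x*y lift into [B], which has only two. *)
have avoid2 : tcount (fun T : {set G''} => identified xB yB \notin T) <= 2.
  rewrite -tB2; have qx : p x = identified xB yB.
    by rewrite /p; case: (separation_quotientP AB (sepBx AB)) => // w _; rewrite eqxx.
  rewrite -qx; apply: leq_trans (tcount_B_avoid gl) _.
  by apply: tcount_leq => T _ /andP[].
have bound2 : ~ isomorphic G'' K4 -> #|triangles G''| = 4 /\
    tcount (fun T : {set G''} => identified xB yB \in T) = 2.
  move=> nK; apply: four_triangles => //.
  by case: (inv_strong inv2) => [/kfourP //|S]; apply: (through_le2 S).
split=> //.
(* K4 has four triangles outright; [bound2] covers every other G''. *)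
- split=> //; have [K|/kfourP/bound2[]//] := boolP (kfour G'').
  by rewrite card_triangles kfour_tcount_all.
- by rewrite card_triangles_induced.
- by case/bound2.
Qed.
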